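(* Let $\Omega$ be a non-empty closed subset of $\mathbb{R}$, let $m\in\mathbb{N}_0$, and let $(s_j)_{j=0}^m$ be a sequence of complex $q\times q$ matrices. (a) Let $\sigma\in\mathcal{M}^q_{\geq}[\Omega;(s_j)_{j=0}^m,=]$ and let $S_\sigma$ be the $\Omega$-Stieltjes transform of $\sigma$. For all $\ell\in\{0,1,\dots,m\}$ and all $\delta\in(0,\pi/2]$, $$\lim_{r\to+\infty}\ \sup_{z\in\Sigma_{r,\delta}}\Bigl\|z^{\ell+1}\Bigl[S_\sigma(z)+\sum_{j=0}^{\ell}z^{-(j+1)}s_j\Bigr]\Bigr\|=0 .$$ (b) Suppose that $\inf\{|\inf\Omega|,|\sup\Omega|\}<+\infty$ and that the matrices $s_0,s_1,\dots,s_m$ are Hermitian. Let $\sigma$ be a non-negative Hermitian $q\times q$ measure on $\Omega$ whose $\Omega$-Stieltjes transform $S_\sigma$ fulfills $$\lim_{y\to+\infty}\Bigl\|(iy)^{m+1}\Bigl[S_\sigma(iy)+\sum_{j=0}^{m}(iy)^{-(j+1)}s_j\Bigr]\Bigr\|=0 .$$ Then $\sigma$ belongs to $\mathcal{M}^q_{\geq}[\Omega;(s_j)_{j=0}^m,=]$.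
   Context: $q$ is a fixed positive integer; $\|\cdot\|$ is the Euclidean (Frobenius) norm of a matrix. A non-negative Hermitian $q\times q$ measure on $\Omega$ is a $\sigma$-additive map from the Borel subsets of $\Omega$ to the set of non-negative Hermitian complex $q\times q$ matrices. $\mathcal{M}^q_{\geq}[\Omega;(s_j)_{j=0}^m,=]$ is the set of all such measures $\sigma$ for which the integrals $\int_\Omega t^j\sigma(dt)$ exist and equal $s_j$ for all $j\in\{0,1,\dots,m\}$. The $\Omega$-Stieltjes transform of $\sigma$ is $S_\sigma:\mathbb{C}\setminus\Omega\to\mathbb{C}^{q\times q}$, $S_\sigma(z)=\int_\Omega\frac{1}{t-z}\sigma(dt)$. For $r>0$ and $\delta\in(0,\pi/2]$, $\Sigma_{r,\delta}=\{z\in\mathbb{C}:|z|\geq r,\ \delta\leq\arg z\leq\pi-\delta\}$. Here $\inf\Omega,\sup\Omega\in[-\infty,+\infty]$ and $|\pm\infty|=+\infty$. *)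

(* Defs.v *)
From HB Require Import structures.
From mathcomp Require Import all_boot all_order all_algebra.
From mathcomp Require Import all_classical all_reals all_analysis.
From mathcomp Require Export complex.

Set Implicit Arguments.
Unset Strict Implicit.
Unset Printing Implicit Defensive.
Import Order.TTheory GRing.Theory Num.Theory.
Import numFieldNormedType.Exports.

Local Open Scope classical_set_scope.
Local Open Scope ring_scope.
Local Open Scope complex_scope.
Local Open Scope sesquilinear_scope.

Local Notation normc := ComplexField.Normc.normc.
Local Notation Re := complex.Re.
Local Notation Im := complex.Im.

Section matrices.
Context {R : realType} {q : nat}.

Definition frobenius (A : 'M[R[i]]_q) : R :=
  Num.sqrt (\sum_(i < q) \sum_(j < q) normc (A i j) ^+ 2).

Definition nonneg_hermitian (A : 'M[R[i]]_q) : Prop :=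
  A \is hermsymmx /\
  forall v : 'cV[R[i]]_q, 0 <= (v ^t* *m A *m v) 0 0.

Lemma normc_le_frobenius (A : 'M[R[i]]_q) i j : normc (A i j) <= frobenius A.
Proof.
have normc_ge0 (z : R[i]) : 0 <= normc z by case: z => a b; exact: sqrtr_ge0.
rewrite -[leLHS]ger0_norm// -sqrtr_sqr ler_wsqrtr//.
rewrite (bigD1 i)//= (bigD1 j)//= -addrA lerDl addr_ge0//.
  by apply: sumr_ge0 => k _; exact: sqr_ge0.
by apply: sumr_ge0 => k _; apply: sumr_ge0 => l _; exact: sqr_ge0.
Qed.

Lemma Re_le_frobenius (A : 'M[R[i]]_q) i j : `|Re (A i j)| <= frobenius A.
Proof.
apply: le_trans (normc_le_frobenius A i j); case: (A i j) => a b /=.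
by rewrite -sqrtr_sqr ler_wsqrtr// lerDl sqr_ge0.
Qed.

Lemma Im_le_frobenius (A : 'M[R[i]]_q) i j : `|Im (A i j)| <= frobenius A.
Proof.
apply: le_trans (normc_le_frobenius A i j); case: (A i j) => a b /=.
by rewrite -sqrtr_sqr ler_wsqrtr// lerDr sqr_ge0.
Qed.

End matrices.

(* Borel subsets of Omega, for the topology induced by the real line. *)
Definition borel_on {R : realType} (Omega : set R) : set (set R) :=
  [set B `&` Omega | B in @measurable _ (measurableTypeR R)].

(* Values of the function outside [borel_on Omega] are unconstrained, and are
   never used below. *)
Record nnherm_measure (R : realType) (q : nat) (Omega : set R) := NnhermMeasure {
  nnherm_measure_fun :> set R -> 'M[R[i]]_q ;
  nnherm_measure_ge0 : forall B, borel_on Omega B ->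
    nonneg_hermitian (nnherm_measure_fun B) ;
  nnherm_measure_sigma_additive : forall F : (set R)^nat,
    (forall n, borel_on Omega (F n)) -> trivIset setT F ->
    frobenius (\sum_(0 <= k < n) nnherm_measure_fun (F k)
               - nnherm_measure_fun (\bigcup_k F k)) @[n --> \oo] --> (0 : R)
}.

Section entries.
Context {R : realType} {q : nat} {Omega : set R}.
Variable sigma : nnherm_measure q Omega.

Lemma borel_onI (B : set (measurableTypeR R)) :
  measurable B -> borel_on Omega (B `&` Omega).
Proof. by move=> mB; exists B. Qed.

Section component.
Variable p : 'M[R[i]]_q -> R.
Hypothesis pB : zmod_morphism p.
Hypothesis p_le : forall A, `|p A| <= frobenius A.

Let p0 : p 0 = 0.
Proof. by rewrite -(subrr 0) pB subrr. Qed.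

Let pD : {morph p : x y / x + y}.
Proof. by move=> x y; rewrite -[y in LHS]opprK pB -[- y]sub0r pB p0 sub0r opprK. Qed.

Lemma component_cvg (F : (set R)^nat) :
  (forall n, borel_on Omega (F n)) -> trivIset setT F ->
  series (fun k => p (sigma (F k))) @ \oo --> p (sigma (\bigcup_k F k)).
Proof.
move=> bF tF; have /cvgrPdist_lt h := nnherm_measure_sigma_additive sigma bF tF.
apply/cvgrPdist_lt => e e0; apply: filterS (h _ e0) => n /=.
rewrite sub0r normrN; apply: le_lt_trans.
have -> : series (fun k => p (sigma (F k))) n
    = p (\sum_(0 <= k < n) sigma (F k)).
  by rewrite (big_morph p pD p0).
by rewrite distrC -pB (le_trans (p_le _))// ler_norm.
Qed.

Definition component (B : set (measurableTypeR R)) : \bar R :=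
  (p (sigma (B `&` Omega)))%:E.

Lemma component0 : component set0 = 0%E.
Proof.
have b0 (n : nat) : borel_on Omega set0.
  by rewrite -(set0I Omega); apply: borel_onI; exact: measurable0.
have /cvgP/cvg_series_cvg_0 h := component_cvg b0 (@trivIset_set0 _ _ setT).
have := cvg_unique _ h (cvg_cst _).
by rewrite /component set0I => <-.
Qed.

Lemma component_finite B : measurable B -> component B \is a fin_num.
Proof. by []. Qed.

Lemma component_sigma_additive : semi_sigma_additive component.
Proof.
move=> F mF tF _; rewrite /component setI_bigcupl.
under eq_fun do rewrite sumEFin.
apply: cvg_EFin; first exact: nearW.
apply: component_cvg => [n|]; first exact: borel_onI.
by apply: trivIset_setIr.
Qed.

End component.

Definition re_entry (i j : 'I_q) (B : set (measurableTypeR R)) : \bar R :=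
  (Re (sigma (B `&` Omega) i j))%:E.

Definition im_entry (i j : 'I_q) (B : set (measurableTypeR R)) : \bar R :=
  (Im (sigma (B `&` Omega) i j))%:E.

Let ReB i j : zmod_morphism (fun A : 'M[R[i]]_q => Re (A i j)).
Proof. by move=> A B; rewrite !mxE; case: (A i j) (B i j) => a b []. Qed.

Let ImB i j : zmod_morphism (fun A : 'M[R[i]]_q => Im (A i j)).
Proof. by move=> A B; rewrite !mxE; case: (A i j) (B i j) => a b []. Qed.

HB.instance Definition _ i j := isCharge.Build _ _ R (re_entry i j)
  (component0 (@ReB i j) (fun A => Re_le_frobenius A i j))
  (component_finite (fun A => Re (A i j)))
  (component_sigma_additive (@ReB i j) (fun A => Re_le_frobenius A i j)).

HB.instance Definition _ i j := isCharge.Build _ _ R (im_entry i j)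
  (component0 (@ImB i j) (fun A => Im_le_frobenius A i j))
  (component_finite (fun A => Im (A i j)))
  (component_sigma_additive (@ImB i j) (fun A => Im_le_frobenius A i j)).

End entries.

(* The integral against a charge does not depend on the Hahn decomposition
   chosen here, by uniqueness of the Jordan decomposition. *)
Section charge_integral.
Context d (T : measurableType d) (R : realType).
Variable nu : {charge set T -> \bar R}.

Definition hahnP : {PN : set T * set T | hahn_decomposition nu PN.1 PN.2} :=
  cid (let: ex_intro P (ex_intro N PN) := Hahn_decomposition nu in
       ex_intro _ (P, N) PN).

Definition charge_integrable (D : set T) (f : T -> R) : Prop :=
  (charge_variation (projT2 hahnP)).-integrable D (EFin \o f).

Definition charge_integral (D : set T) (f : T -> R) : R :=
  Rintegral (jordan_pos (projT2 hahnP)) D f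
  - Rintegral (jordan_neg (projT2 hahnP)) D f.

End charge_integral.

Section integral.
Context {R : realType} {q : nat} {Omega : set R}.
Variable sigma : nnherm_measure q Omega.

(* Integrability of f with respect to the variation of each complex measure
   sigma_ij, expressed through real and imaginary parts. *)
Definition mx_integrable (f : R -> R[i]) : Prop := forall i j : 'I_q,
  [/\ charge_integrable (re_entry sigma i j) Omega (@Re R \o f),
      charge_integrable (re_entry sigma i j) Omega (@Im R \o f),
      charge_integrable (im_entry sigma i j) Omega (@Re R \o f) &
      charge_integrable (im_entry sigma i j) Omega (@Im R \o f)].

Definition mx_integral (f : R -> R[i]) : 'M[R[i]]_q := \matrix_(i, j)
  ((charge_integral (re_entry sigma i j) Omega (@Re R \o f)
    - charge_integral (im_entry sigma i j) Omega (@Im R \o f))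
   +i* (charge_integral (re_entry sigma i j) Omega (@Im R \o f)
        + charge_integral (im_entry sigma i j) Omega (@Re R \o f))).

(* Meaningful only for z outside Omega. *)
Definition stieltjes (z : R[i]) : 'M[R[i]]_q :=
  mx_integral (fun t => (t%:C - z)^-1).

End integral.

Definition moment_class {R : realType} {q : nat} (Omega : set R) {m : nat}
    (s : 'I_m.+1 -> 'M[R[i]]_q) : set (nnherm_measure q Omega) :=
  [set sigma | forall j : 'I_m.+1,
    mx_integrable sigma (fun t => (t ^+ j)%:C) /\
    mx_integral sigma (fun t => (t ^+ j)%:C) = s j].
Arguments moment_class {R q} Omega {m} s _.

Section sector.
Context {R : realType}.

(* Principal argument; arbitrary at 0, where every angle qualifies. *)
Definition carg (z : R[i]) : R := xget 0 [set phi : R |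
  - pi < phi <= pi /\ z = (normc z)%:C * (cos phi +i* sin phi)].

Definition sector (r delta : R) : set (R[i]) :=
  [set z | r <= normc z /\ delta <= carg z <= pi - delta].

End sector.

(* Main.v *)
From HB Require Import structures.
Require Import Defs.
From mathcomp Require Import all_boot all_order all_algebra.
From mathcomp Require Import all_classical all_reals all_analysis.
From mathcomp Require Import measurable_realfun ring lra.
Import Order.TTheory GRing.Theory Num.Theory.
Import numFieldNormedType.Exports.

(** Reduction to positive measures. If sigma is a nonnegative Hermitian measure,
    its (i, j) entry is dominated by the sum of its i-th and j-th diagonal
    entries, which are finite positive measures ([entry_le]). Hence the norm
    of a matrix integral is at most a constant times the sum of the integrals
    of a majorant against the diagonal measures ([frobenius_mx_integral_le]),
    and integrability can be tested on these measures.

    Part (a). Put R_l(z) = z^l [S(z) + sum_(j < l) z^(-j-1) s_j]. From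
    R_(l+1) = z R_l + s_l and t^(l+1)/(t-z) = z t^l/(t-z) + t^l one gets by
    induction that R_l(z) is the integral of t^l/(t-z) as soon as s_0, ...,
    s_(l-1) are the moments of sigma ([remainder_integral]). In the sector,
    |t-z| is at least sin(delta) |t| and at least sin(delta) r, so the
    integrand of R_(l+1) is bounded by |t|^l min(1, |t|/r) / sin(delta),
    uniformly in z. It tends to 0 pointwise and is dominated by a multiple of
    |t|^l, whose integral is finite ([sector_remainder_cvg0]).

    Part (b). Dividing by iy, the expansion at order m gives the one at each
    lower order. The moments are then identified one after the other
    ([has_moments_of_asymptotics]). If s_0, ..., s_(k-1) are the first
    moments, R_(k+1)(iy) = iy (integral of t^k/(t-iy)) + s_k, and the real part
    of a diagonal entry says that the integrals of t^k y^2/(t^2+y^2) against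
    that diagonal measure converge ([damped_moment_cvg]). On a semibounded
    set, t^k has a constant sign up to a bounded function, so the integrals
    of |t|^k y^2/(t^2+y^2) are bounded, and Fatou's lemma makes t^k
    integrable ([damped_moment_integrable]). Now the expansion of part (a)
    holds with the actual k-th moment in place of s_k; comparing the two
    expansions shows that they agree ([has_momentsS]). *)

Set Implicit Arguments.
Unset Strict Implicit.
Unset Printing Implicit Defensive.

Local Open Scope classical_set_scope.
Local Open Scope ring_scope.
Local Open Scope complex_scope.
Local Notation normc := ComplexField.Normc.normc.
Local Notation Re := complex.Re.
Local Notation Im := complex.Im.

(** * Integrals against comparable measures *)

Section measure_comparison.
Context d (T : measurableType d) (R : realType).
Variables (D : set T) (mD : measurable D).
Implicit Types m : {measure set T -> \bar R}.

Lemma ge0_le_measure_integral_in m1 m2 (f : T -> \bar R) :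
  (forall S, measurable S -> (m1 S <= m2 S)%E) ->
  (forall x, D x -> (0 <= f x)%E) -> measurable_fun D f ->
  (\int[m1]_(x in D) f x <= \int[m2]_(x in D) f x)%E.
Proof.
move=> m12 f0 mf; rewrite !(integral_mkcond D).
apply: ge0_le_measure_integral => //.
  by move=> x; apply: erestrict_ge0.
exact/(measurable_restrictT _ mD).
Qed.

Lemma le_measure_integrable m1 m2 (f : T -> \bar R) :
  (forall S, measurable S -> (m1 S <= m2 S)%E) ->
  m2.-integrable D f -> m1.-integrable D f.
Proof.
move=> m12 /integrableP[mf foo]; apply/integrableP; split => //.
apply: le_lt_trans foo; apply: ge0_le_measure_integral_in => //.
exact: measurableT_comp.
Qed.

Lemma integrable_measure_add m1 m2 (f : T -> \bar R) :
  m1.-integrable D f -> m2.-integrable D f ->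
  (measure_add m1 m2).-integrable D f.
Proof.
move=> /integrableP[mf f1] /integrableP[_ f2]; apply/integrableP; split => //.
rewrite ge0_integral_measure_add//; last exact: measurableT_comp.
exact: lte_add_pinfty.
Qed.

Lemma le_measure_Rintegral m1 m2 (f : T -> R) :
  (forall S, measurable S -> (m1 S <= m2 S)%E) ->
  (forall x, D x -> 0 <= f x) -> m2.-integrable D (EFin \o f) ->
  Rintegral m1 D f <= Rintegral m2 D f.
Proof.
move=> m12 f0 if2; have if1 := le_measure_integrable m12 if2.
apply: fine_le; [exact: integrable_fin_num|exact: integrable_fin_num|].
apply: ge0_le_measure_integral_in => //.
exact: measurable_int if2.
Qed.

Lemma Rintegral_measure_add m1 m2 (f : T -> R) :
  m1.-integrable D (EFin \o f) -> m2.-integrable D (EFin \o f) ->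
  Rintegral (measure_add m1 m2) D f = Rintegral m1 D f + Rintegral m2 D f.
Proof.
move=> if1 if2; rewrite /Rintegral integral_measure_add//.
by rewrite fineD//; exact: integrable_fin_num.
Qed.

End measure_comparison.

(** * Integration against a charge *)

Section charge_integral_theory.
Context d (T : measurableType d) (R : realType).
Variable nu : {charge set T -> \bar R}.
Variables (D : set T) (mD : measurable D).
Local Notation pos := (jordan_pos (projT2 (hahnP nu))).
Local Notation neg := (jordan_neg (projT2 (hahnP nu))).

(** The variation is the sum of the two Jordan parts: each part lies below it,
    and integrals over a sum of measures split. *)
Lemma charge_integrableP (f : T -> R) : charge_integrable nu D f <->
  pos.-integrable D (EFin \o f) /\ neg.-integrable D (EFin \o f).
Proof.
split=> [fi|[fp fn]].
  split; apply: (le_measure_integrable mD _ fi) => S _; rewrite /charge_variation.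
    by rewrite leeDl.
  by rewrite leeDr.
rewrite /charge_integrable.
apply: (le_measure_integrable mD _ (integrable_measure_add mD fp fn)) => S _.
by rewrite [X in (_ <= X)%E](measure_addE pos neg S).
Qed.

Lemma charge_integrableD (f g : T -> R) :
  charge_integrable nu D f -> charge_integrable nu D g ->
  charge_integrable nu D (fun x => f x + g x).
Proof. exact: integrableD. Qed.

Lemma charge_integrableZ (c : R) (f : T -> R) : charge_integrable nu D f ->
  charge_integrable nu D (fun x => c * f x).
Proof. by move=> fi; exact: (integrableZl mD c fi). Qed.

Lemma charge_integralD (f g : T -> R) :
  charge_integrable nu D f -> charge_integrable nu D g ->
  charge_integral nu D (fun x => f x + g x) =
  charge_integral nu D f + charge_integral nu D g.
Proof.
move=> /charge_integrableP[fp fn] /charge_integrableP[gp gn].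
by rewrite /charge_integral !RintegralD// opprD addrACA.
Qed.

Lemma charge_integralZ (c : R) (f : T -> R) : charge_integrable nu D f ->
  charge_integral nu D (fun x => c * f x) = c * charge_integral nu D f.
Proof.
by move=> /charge_integrableP[fp fn]; rewrite /charge_integral !RintegralZl// mulrBr.
Qed.

Section dominated.
Variable m : {measure set T -> \bar R}.
Hypothesis nu_le : forall S, measurable S -> (`|nu S| <= m S)%E.

(** A Jordan part is, up to sign, the restriction of the charge to one side of
    a Hahn decomposition, so a setwise bound on the charge passes to it. This
    turns estimates for a charge into estimates for an ordinary measure. *)
Lemma jordan_pos_le S : measurable S -> (pos S <= m S)%E.
Proof.
move=> mS; have [[mP _] _ _ _] := projT2 (hahnP nu).
rewrite jordan_posE cjordan_posE /crestr0 mem_set// /crestr.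
apply: (le_trans (lee_abs _)); apply: le_trans (nu_le _) _.
  exact: measurableI.
by rewrite le_measure// inE//; exact: measurableI.
Qed.

Lemma jordan_neg_le S : measurable S -> (neg S <= m S)%E.
Proof.
move=> mS; have [_ [mN _] _ _] := projT2 (hahnP nu).
rewrite jordan_negE cjordan_negE /crestr0 mem_set// /crestr.
apply: (le_trans (lee_abs _)); rewrite abseN; apply: le_trans (nu_le _) _.
  exact: measurableI.
by rewrite le_measure// inE//; exact: measurableI.
Qed.

Lemma dominated_charge_integrable (f : T -> R) :
  m.-integrable D (EFin \o f) -> charge_integrable nu D f.
Proof.
move=> fi; apply/charge_integrableP; split;
  apply: le_measure_integrable fi => //; [exact: jordan_pos_le|exact: jordan_neg_le].
Qed.

Lemma dominated_charge_integral_le (f : T -> R) : m.-integrable D (EFin \o f) ->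
  `|charge_integral nu D f| <= Rintegral m D (fun x => `|f x|) *+ 2.
Proof.
move=> fi; have /charge_integrableP[fp fn] := dominated_charge_integrable fi.
rewrite mulr2n (le_trans (ler_normB _ _))// lerD//.
  apply: le_trans (le_normr_Rintegral mD fp) _.
  by apply: le_measure_Rintegral => //; [exact: jordan_pos_le|exact: integrable_norm].
apply: le_trans (le_normr_Rintegral mD fn) _.
by apply: le_measure_Rintegral => //; [exact: jordan_neg_le|exact: integrable_norm].
Qed.

End dominated.

Section nonnegative.
Hypothesis nu_ge0 : forall S, measurable S -> (0 <= nu S)%E.

(** On the negative side of a Hahn decomposition the charge is at once
    nonnegative and nonpositive. *)
Lemma ge0_jordan_neg S : measurable S -> neg S = 0%E.
Proof.
move=> mS; have [_ [mN negN] _ _] := projT2 (hahnP nu).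
have mSN : measurable (S `&` (projT1 (hahnP nu)).2) by exact: measurableI.
rewrite jordan_negE cjordan_negE /crestr0 mem_set// /crestr.
apply/eqP; rewrite oppe_eq0 eq_le nu_ge0// andbT.
exact: negN.
Qed.

Lemma ge0_jordan_pos S : measurable S -> pos S = nu S.
Proof.
move=> mS; rewrite (jordan_decomp (projT2 (hahnP nu)) mS) /cadd/= cscaleN1.
have := ge0_jordan_neg mS; rewrite jordan_negE => ->.
by rewrite oppe0 adde0.
Qed.

Lemma ge0_charge_integral (f : T -> R) :
  charge_integral nu D f = Rintegral pos D f.
Proof.
rewrite /charge_integral /Rintegral.
rewrite (@eq_measure_integral _ _ _ D (@mzero _ T R) neg); last first.
  by move=> A mA _; exact: ge0_jordan_neg.
by rewrite integral_measure_zero subr0.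
Qed.

End nonnegative.

End charge_integral_theory.

(** * Entries of a nonnegative Hermitian matrix *)

Section nonneg_hermitian_entries.
Local Open Scope sesquilinear_scope.
Context {R : realType} {q : nat}.
Variable A : 'M[R[i]]_q.
Hypothesis A_ge0 : nonneg_hermitian A.

(** The value of the Hermitian form at e_i + c e_j. *)
Lemma nonneg_hermitian_form (i j : 'I_q) (c : R[i]) :
  0 <= A i i + c * A i j + (c^*%C * A j i + c^*%C * (c * A j j)).
Proof.
have [_ /(_ (delta_mx i 0 + c *: delta_mx j 0))] := A_ge0.
have -> : (delta_mx i 0 + c *: delta_mx j 0)^t* =
   delta_mx 0 i + c^*%C *: delta_mx 0 j :> 'rV[R[i]]_q.
  apply/matrixP => a b; rewrite !mxE rmorphD rmorphM !rmorph_nat.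
  by rewrite !(andbC _ (a == 0)) (ord1 a) eqxx.
rewrite !mulmxDl !mulmxDr -!scalemxAl -!scalemxAr.
by rewrite -!rowE -!colE !mxE.
Qed.

Lemma hermitian_entry i j : A j i = (A i j)^*%C.
Proof.
have [/is_hermitianmxP hA _] := A_ge0.
by rewrite [in LHS]hA expr0 scale1r !mxE.
Qed.

Lemma nonneg_hermitian_diag i : 0 <= Re (A i i).
Proof.
have := nonneg_hermitian_form i i 0.
rewrite !(mul0r, mulr0, addr0, conjc0) lecE.
by move=> /andP[].
Qed.

(** The Hermitian form is nonnegative at e_i + c e_j for c = 1, -1, i and -i;
    the first two values bound the real part of the entry and the last two
    its imaginary part. *)
Lemma nonneg_hermitian_offdiag i j :
  `|Re (A i j)| <= Re (A i i) + Re (A j j) /\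
  `|Im (A i j)| <= Re (A i i) + Re (A j j).
Proof.
have := nonneg_hermitian_diag i; have := nonneg_hermitian_diag j.
have form_Re c : 0 <= Re (A i i + c * A i j +
    (c^*%C * A j i + c^*%C * (c * A j j))).
  by have := nonneg_hermitian_form i j c; rewrite lecE => /andP[].
move: (form_Re 1%:C) (form_Re (-1)%:C) (form_Re 'i) (form_Re (0 -i* 1)).
rewrite (hermitian_entry i j).
case: (A i i) (A i j) (A j j) => [a a'] [b b'] [d d'] /=.
rewrite !ler_norml => h1 h2 h3 h4 d0 a0.
split; apply/andP; split; lra.
Qed.

End nonneg_hermitian_entries.

(** * Modulus and Frobenius norm *)

Section frobenius.
Context {R : realType} {q : nat}.

(** Expanding the square of the sum leaves nonnegative cross terms. *)
Lemma sum_sqr_le (I : finType) (x : I -> R) : (forall i, 0 <= x i) ->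
  \sum_i x i ^+ 2 <= (\sum_i x i) ^+ 2.
Proof.
move=> x0; rewrite expr2 mulr_suml ler_sum// => i _.
rewrite expr2 ler_wpM2l// (bigD1 i)//= lerDl.
by apply: sumr_ge0.
Qed.

Lemma normc_ge0 (z : R[i]) : 0 <= normc z.
Proof. by case: z => a b; exact: sqrtr_ge0. Qed.

Lemma Re_le_normc (z : R[i]) : `|Re z| <= normc z.
Proof. by case: z => a b /=; rewrite -sqrtr_sqr ler_wsqrtr// lerDl sqr_ge0. Qed.

Lemma Im_le_normc (z : R[i]) : `|Im z| <= normc z.
Proof. by case: z => a b /=; rewrite -sqrtr_sqr ler_wsqrtr// lerDr sqr_ge0. Qed.

Lemma normc_le_ReIm (z : R[i]) : normc z <= `|Re z| + `|Im z|.
Proof.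
case: z => a b /=; rewrite -[leRHS]ger0_norm ?addr_ge0// -sqrtr_sqr ler_wsqrtr//.
by rewrite sqrrD !real_normK ?num_real// lerD2r lerDl mulrn_wge0// mulr_ge0.
Qed.

Lemma frobenius_ge0 (A : 'M[R[i]]_q) : 0 <= frobenius A.
Proof. exact: sqrtr_ge0. Qed.

Lemma frobenius_le_sum (A : 'M[R[i]]_q) :
  frobenius A <= \sum_i \sum_j normc (A i j).
Proof.
have s0 i : 0 <= \sum_j normc (A i j) by apply: sumr_ge0 => j _; exact: normc_ge0.
rewrite /frobenius -[leRHS]ger0_norm ?sumr_ge0// -sqrtr_sqr ler_wsqrtr//.
apply: le_trans (sum_sqr_le s0); apply: ler_sum => i _.
by apply: sum_sqr_le => j; exact: normc_ge0.
Qed.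

End frobenius.

(** * The matrix integral *)

Section mx_integral_theory.
Context {R : realType} {q : nat} {Omega : set R}.
Hypothesis mOmega : measurable (Omega : set (measurableTypeR R)).
Variable sigma : nnherm_measure q Omega.
Implicit Types (i j k : 'I_q) (f g : R -> R[i]).

(** The charge [re_entry sigma i i] is nonnegative on measurable sets only,
    its values elsewhere being arbitrary; its positive Jordan part agrees with
    it on measurable sets and is a measure. *)
Definition diag_measure i := jordan_pos (projT2 (hahnP (re_entry sigma i i))).

HB.instance Definition _ i := FiniteMeasure.on (diag_measure i).

Lemma re_diag_ge0 i (S : set (measurableTypeR R)) :
  measurable S -> (0 <= re_entry sigma i i S)%E.
Proof.
move=> mS; rewrite lee_fin; apply: nonneg_hermitian_diag.
by apply: nnherm_measure_ge0; exact: borel_onI.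
Qed.

Lemma diag_measureE i (S : set (measurableTypeR R)) :
  measurable S -> diag_measure i S = re_entry sigma i i S.
Proof. by move=> mS; apply: ge0_jordan_pos => //; exact: re_diag_ge0. Qed.

(** All entries of sigma are dominated by its diagonal entries, so that
    integrability and convergence to 0 need only be checked for the finitely
    many positive measures [diag_measure sigma k]. *)
Lemma entry_le i j (S : set (measurableTypeR R)) : measurable S ->
  (`|re_entry sigma i j S| <= measure_add (diag_measure i) (diag_measure j) S)%E /\
  (`|im_entry sigma i j S| <= measure_add (diag_measure i) (diag_measure j) S)%E.
Proof.
move=> mS.
have -> : measure_add (diag_measure i) (diag_measure j) S =
    (re_entry sigma i i S + re_entry sigma j j S)%E.
  transitivity (diag_measure i S + diag_measure j S)%E; first exact: measure_addE.
  by rewrite !diag_measureE.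
rewrite /re_entry /im_entry -EFinD !lee_fin.
apply: nonneg_hermitian_offdiag.
by apply: nnherm_measure_ge0; exact: borel_onI.
Qed.

Section domination.
Variables (f : R -> R[i]) (G : R -> R).
Hypothesis mRe : measurable_fun (Omega : set (measurableTypeR R)) (@Re R \o f).
Hypothesis mIm : measurable_fun (Omega : set (measurableTypeR R)) (@Im R \o f).
Hypothesis fG : forall t, Omega t -> normc (f t) <= G t.
Hypothesis iG : forall k, (diag_measure k).-integrable Omega (EFin \o G).

Let iP (p : R -> R) i j :
  measurable_fun (Omega : set (measurableTypeR R)) p ->
  (forall t, Omega t -> `|p t| <= G t) ->
  (measure_add (diag_measure i) (diag_measure j)).-integrable Omega (EFin \o p).
Proof.
move=> mp pG; apply: (le_integrable mOmega _ _
  (integrable_measure_add mOmega (iG i) (iG j))).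
  exact/measurable_EFinP.
move=> t Ot /=; rewrite lee_fin (le_trans (pG t Ot))// ler_norm//.
Qed.

Let ReG t : Omega t -> `|Re (f t)| <= G t.
Proof. by move=> Ot; apply: le_trans (fG Ot); exact: Re_le_normc. Qed.

Let ImG t : Omega t -> `|Im (f t)| <= G t.
Proof. by move=> Ot; apply: le_trans (fG Ot); exact: Im_le_normc. Qed.

Lemma mx_integrable_dominated : mx_integrable sigma f.
Proof.
by move=> i j; split; apply: dominated_charge_integrable (iP i j _ _) => //;
  move=> S mS; have [] := entry_le i j mS.
Qed.

Let bound (p : R -> R) (nu : {charge set (measurableTypeR R) -> \bar R}) i j :
  (forall S, measurable S ->
    (`|nu S| <= measure_add (diag_measure i) (diag_measure j) S)%E) ->
  measurable_fun (Omega : set (measurableTypeR R)) p ->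
  (forall t, Omega t -> `|p t| <= G t) ->
  `|charge_integral nu Omega p| <=
  (Rintegral (diag_measure i) Omega G + Rintegral (diag_measure j) Omega G) *+ 2.
Proof.
move=> nu_le mp pG.
apply: le_trans (dominated_charge_integral_le mOmega nu_le (iP i j mp pG)) _.
rewrite lerMn2r/= -Rintegral_measure_add//.
apply: le_Rintegral => //; first exact: (integrable_norm (iP i j mp pG)).
exact: (integrable_measure_add mOmega (iG i) (iG j)).
all: exact: iG.
Qed.

(** Each entry of the integral combines four charge integrals, and each of
    these is at most 2 (I i + I j), where I k is the integral of the majorant
    against the k-th diagonal measure. Summing 8 (I i + I j) over i and j gives
    16 q times the sum of all I k. *)
Lemma frobenius_mx_integral_le : frobenius (mx_integral sigma f) <=
  (16 * q)%:R * \sum_k Rintegral (diag_measure k) Omega G.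
Proof.
pose I k := Rintegral (diag_measure k) Omega G.
apply: (le_trans (frobenius_le_sum _)).
apply: (@le_trans _ _ (\sum_i \sum_j (I i + I j) *+ 8)); last first.
  rewrite -/(\sum_k I k).
  under eq_bigr do rewrite sumrMnl big_split/= sumr_const card_ord.
  rewrite sumrMnl big_split/= sumrMnl sumr_const card_ord.
  by rewrite mulr_natl -mulr2n -!mulrnA [X in _ *+ X]mulnC.
apply: ler_sum => i _; apply: ler_sum => j _.
apply: (le_trans (normc_le_ReIm _)); rewrite mxE /=.
have hr S (mS : measurable S) := (entry_le i j mS).1.
have hi S (mS : measurable S) := (entry_le i j mS).2.
have h1 := bound hr mRe ReG.
have h2 := bound hr mIm ImG.
have h3 := bound hi mRe ReG.
have h4 := bound hi mIm ImG.
rewrite -[Rintegral _ _ _ + _]/(I i + I j) in h1 h2 h3 h4.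
have -> : (I i + I j) *+ 8 = ((I i + I j) *+ 2 + (I i + I j) *+ 2) +
   ((I i + I j) *+ 2 + (I i + I j) *+ 2) by ring.
apply: lerD.
  by apply: (le_trans (ler_normB _ _)); apply: lerD.
by apply: (le_trans (ler_normD _ _)); apply: lerD.
Qed.

End domination.

Section linearity.
Variables (c : R[i]) (f g : R -> R[i]).
Hypotheses (fi : mx_integrable sigma f) (gi : mx_integrable sigma g).

Let ReE : @Re R \o (fun t => c * f t + g t) =
  (fun t => (Re c * Re (f t) + - Im c * Im (f t)) + Re (g t)).
Proof.
by apply/funext => t /=; case: c (f t) (g t) => [a b] [x y] [u v] /=; rewrite mulNr.
Qed.

Let ImE : @Im R \o (fun t => c * f t + g t) =
  (fun t => (Re c * Im (f t) + Im c * Re (f t)) + Im (g t)).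
Proof.
by apply/funext => t /=; case: c (f t) (g t) => [a b] [x y] [u v].
Qed.

Lemma mx_integrable_lin : mx_integrable sigma (fun t => c * f t + g t).
Proof.
move=> i j; have [f1 f2 f3 f4] := fi i j; have [g1 g2 g3 g4] := gi i j.
by split; rewrite ?ReE ?ImE; do 2?[apply: charge_integrableD => //];
  apply: charge_integrableZ.
Qed.

Lemma mx_integral_lin : mx_integral sigma (fun t => c * f t + g t) =
  c *: mx_integral sigma f + mx_integral sigma g.
Proof.
apply/matrixP => i j; rewrite !mxE.
have [f1 f2 f3 f4] := fi i j; have [g1 g2 g3 g4] := gi i j.
rewrite ReE ImE.
rewrite !charge_integralD//; do ?[apply: charge_integrableD => //];
  do ?[exact: charge_integrableZ].
rewrite !charge_integralZ//.
case: c => a b /=.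
rewrite -[RHS]/(Complex _ _); congr Complex; rewrite /=; ring.
Qed.

End linearity.

Lemma mx_integrable_diag f k : mx_integrable sigma f ->
  (diag_measure k).-integrable Omega (EFin \o (@Re R \o f)) /\
  (diag_measure k).-integrable Omega (EFin \o (@Im R \o f)).
Proof.
by move=> /(_ k k)[/(charge_integrableP _ mOmega)[? _]
  /(charge_integrableP _ mOmega)[? _] _ _].
Qed.

Lemma im_diag0 k (S : set (measurableTypeR R)) : measurable S ->
  im_entry sigma k k S = 0%E.
Proof.
move=> mS; rewrite /im_entry.
have := @hermitian_entry _ _ _ (nnherm_measure_ge0 sigma (borel_onI mS)) k k.
case: (sigma _ k k) => a b [] /= bN; congr EFin; lra.
Qed.

(** A Hermitian matrix has a real diagonal, so a diagonal entry of the integral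
    is an integral against a positive measure. The imaginary part is the one
    that matters below: on the imaginary axis the imaginary part of the
    Cauchy kernel has a constant sign. *)
Lemma mx_integral_diag f k : mx_integrable sigma f ->
  Im (mx_integral sigma f k k) = Rintegral (diag_measure k) Omega (@Im R \o f).
Proof.
move=> /(_ k k)[_ _ /(charge_integrableP _ mOmega)[/measurable_int mf _] _].
have nu_le (S : set (measurableTypeR R)) : measurable S ->
    (`|im_entry sigma k k S| <= @mzero _ (measurableTypeR R) R S)%E.
  by move=> mS; rewrite im_diag0// abse0.
have i0 : (@mzero _ (measurableTypeR R) R).-integrable Omega
    (EFin \o (@Re R \o f)).
  by apply/integrableP; split => //; rewrite integral_measure_zero.
have := dominated_charge_integral_le mOmega nu_le i0.
rewrite (_ : Rintegral _ _ _ = 0); last first.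
  by rewrite /Rintegral integral_measure_zero.
rewrite mul0rn normr_le0 => /eqP re0.
rewrite mxE /= re0 addr0 ge0_charge_integral// => S mS.
exact: re_diag_ge0.
Qed.

End mx_integral_theory.

(** * The remainder of the asymptotic expansion *)

Section remainder.
Context {R : realType} {q : nat}.
Implicit Types (S : 'M[R[i]]_q) (s : nat -> 'M[R[i]]_q).

(** Only [s 0], ..., [s l.-1] enter, so that the quantity of the theorem for
    the index l is the remainder at [l.+1]. *)
Definition stieltjes_remainder S s (z : R[i]) (l : nat) : 'M[R[i]]_q :=
  z ^+ l *: (S + \sum_(j < l) z ^- j.+1 *: s j).

Lemma stieltjes_remainder0 S s z : stieltjes_remainder S s z 0 = S.
Proof. by rewrite /stieltjes_remainder expr0 scale1r big_ord0 addr0. Qed.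

Lemma stieltjes_remainderS S s z l : z != 0 ->
  stieltjes_remainder S s z l.+1 = z *: stieltjes_remainder S s z l + s l.
Proof.
move=> z0; rewrite /stieltjes_remainder big_ord_recr/= addrA scalerDr.
by rewrite [_ *: (_ *: s l)]scalerA mulfV ?expf_neq0// scale1r exprS -scalerA.
Qed.

End remainder.

Section kernel.
Context {R : realType}.
Implicit Types (z : R[i]) (t : R).

Lemma Im_neq0 z t : Im z != 0 -> t%:C - z != 0.
Proof.
by case: z => a b /= b0; rewrite eq_complex /= negb_and sub0r oppr_eq0 b0 orbT.
Qed.

Lemma Im_neq0_neq0 z : Im z != 0 -> z != 0.
Proof. by case: z => a b /= b0; rewrite eq_complex /= negb_and b0 orbT. Qed.

(** Write t = z + (t - z) in the numerator. *)
Lemma kernel_recr z t l : Im z != 0 ->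
  (t ^+ l.+1)%:C * (t%:C - z)^-1 =
  z * ((t ^+ l)%:C * (t%:C - z)^-1) + (t ^+ l)%:C.
Proof.
move=> /(Im_neq0 t) tz; rewrite exprSr rmorphM.
move: tz; set T := t%:C; set P := (t ^+ l)%:C => tz.
by apply: (mulIf tz); rewrite mulrDl -!mulrA mulVf// !mulr1; ring.
Qed.

Lemma ReZ (x : R) z : Re (x%:C * z) = x * Re z.
Proof. by case: z => a b /=; rewrite mul0r subr0. Qed.

Lemma ImZ (x : R) z : Im (x%:C * z) = x * Im z.
Proof. by case: z => a b /=; rewrite mul0r addr0. Qed.

Lemma normc_real (x : R) : normc x%:C = `|x|.
Proof. by rewrite /= expr0n addr0 sqrtr_sqr. Qed.

Lemma measurable_cauchy_Re (D : set (measurableTypeR R)) z : Im z != 0 ->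
  measurable_fun D (@Re R \o (fun t => (t%:C - z)^-1)).
Proof.
case: z => a b /= b0; apply: measurable_funTS.
apply: continuous_measurable_fun => t /=.
have h : (t - a) ^+ 2 + (0 - b) ^+ 2 != 0.
  by rewrite gt_eqF// ltr_wpDl ?sqr_ge0// sub0r sqrrN exprn_even_gt0.
have c1 : (fun u : R => u - a) @ t --> t - a by apply: cvgB => //; exact: cvg_cst.
apply: cvgM => //; apply: cvgV => //; apply: cvgD; last exact: cvg_cst.
exact: cvgM.
Qed.

Lemma measurable_cauchy_Im (D : set (measurableTypeR R)) z : Im z != 0 ->
  measurable_fun D (@Im R \o (fun t => (t%:C - z)^-1)).
Proof.
case: z => a b /= b0; apply: measurable_funTS.
apply: continuous_measurable_fun => t /=.
have h : (t - a) ^+ 2 + (0 - b) ^+ 2 != 0.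
  by rewrite gt_eqF// ltr_wpDl ?sqr_ge0// sub0r sqrrN exprn_even_gt0.
have c1 : (fun u : R => u - a) @ t --> t - a by apply: cvgB => //; exact: cvg_cst.
apply: cvgN; apply: cvgM; first exact: cvg_cst.
apply: cvgV => //; apply: cvgD; last exact: cvg_cst.
exact: cvgM.
Qed.

End kernel.

Section moments.
Context {R : realType} {q : nat} {Omega : set R}.
Hypothesis mOmega : measurable (Omega : set (measurableTypeR R)).
Variable sigma : nnherm_measure q Omega.

Definition has_moments (s : nat -> 'M[R[i]]_q) (l : nat) : Prop :=
  forall j, (j < l)%N -> mx_integrable sigma (fun t => (t ^+ j)%:C) /\
    mx_integral sigma (fun t => (t ^+ j)%:C) = s j.

(** By [kernel_recr], multiplying the integral of t^l/(t-z) by z and adding the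
    l-th moment gives the integral of t^(l+1)/(t-z); the remainder obeys the
    same recursion. Integrability follows along the same induction, from the
    case l = 0 where the kernel is bounded by 1/|Im z|. *)
Lemma remainder_integral s z l : Im z != 0 -> has_moments s l ->
  mx_integrable sigma (fun t => (t ^+ l)%:C * (t%:C - z)^-1) /\
  stieltjes_remainder (stieltjes sigma z) s z l =
  mx_integral sigma (fun t => (t ^+ l)%:C * (t%:C - z)^-1).
Proof.
move=> z0; elim: l => [_|l ih hs].
  have -> : (fun t : R => (t ^+ 0)%:C * (t%:C - z)^-1) = (fun t => (t%:C - z)^-1).
    by apply/funext => t; rewrite expr0 mul1r.
  split; last by rewrite stieltjes_remainder0.
  apply: (@mx_integrable_dominated _ _ _ _ _ _ (cst `|Im z|^-1)) => //.
  - exact: measurable_cauchy_Re.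
  - exact: measurable_cauchy_Im.
  - move=> t _; rewrite ComplexField.Normc.normcV lef_pV2 ?posrE ?normr_gt0//.
      by apply: le_trans (Im_le_normc _); case: (z) => a b /=; rewrite sub0r normrN.
    rewrite lt_def normc_ge0 andbT; apply: contra (Im_neq0 t z0).
    by move=> /eqP/ComplexField.Normc.eq0_normc ->.
  - by move=> k; exact: finite_measure_integrable_cst.
have [ii ie] := ih (fun j jl => hs j (ltnW jl)).
have [il el] := hs l (ltnSn l).
have -> : (fun t : R => (t ^+ l.+1)%:C * (t%:C - z)^-1) =
    (fun t => z * ((t ^+ l)%:C * (t%:C - z)^-1) + (t ^+ l)%:C).
  by apply/funext => t; exact: kernel_recr.
split; first exact: mx_integrable_lin.
by rewrite mx_integral_lin// stieltjes_remainderS ?Im_neq0_neq0// ie el.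
Qed.

End moments.

(** * Decay of the remainder *)

Section tail.
Context {R : realType}.

(** If |t - z| is at least both |t| and r, this is a majorant of
    |t^(l+1)/(t - z)|. The modulus of the quotient keeps the weight between 0
    and |t|^l for every real r, as a dominated convergence argument along an
    arbitrary sequence of values of r requires. *)
Definition tail_weight (l : nat) (r t : R) : R :=
  `|t| ^+ l * Num.min 1 `|t / r|.

Lemma tail_weight_ge0 l r t : 0 <= tail_weight l r t.
Proof. by rewrite mulr_ge0 ?exprn_ge0// le_min ler01/=. Qed.

Lemma tail_weight_le l r t : tail_weight l r t <= `|t ^+ l|.
Proof. by rewrite normrX ler_piMr ?exprn_ge0// ge_min lexx. Qed.

Lemma measurable_tail_weight (D : set (measurableTypeR R)) l r :
  measurable_fun D (tail_weight l r).
Proof.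
apply: measurable_funM.
  by apply: measurable_funX; exact: normr_measurable.
apply: measurable_minr => //; apply: measurableT_comp => //.
exact: measurable_funM.
Qed.

Lemma tail_weight_cvg0 l (t : R) : tail_weight l r t @[r --> +oo] --> 0.
Proof.
have h : `|t| ^+ l * `|t / r| @[r --> +oo] --> `|t| ^+ l * `|t * 0|.
  apply: cvgM; first exact: cvg_cst.
  apply: cvg_norm; apply: cvgM; first exact: cvg_cst.
  by apply/gtr0_cvgV0; [exact: nbhs_pinfty_gt|exact: cvg_id].
rewrite mulr0 normr0 mulr0 in h.
apply: squeeze_cvgr h; last exact: (@cvg_cst _ (0 : R)).
apply: nearW => r; rewrite tail_weight_ge0/=.
by rewrite ler_wpM2l ?exprn_ge0// ge_min lexx orbT.
Qed.

(** Dominated convergence with the majorant |t|^l, along every sequence of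
    values of r that tends to infinity. *)
Lemma tail_integral_cvg0 (m : {measure set (measurableTypeR R) -> \bar R})
    (D : set (measurableTypeR R)) (mD : measurable D) (l : nat) :
  m.-integrable D (EFin \o (fun t => t ^+ l)) ->
  Rintegral m D (tail_weight l r) @[r --> +oo] --> (0 : R).
Proof.
move=> il; apply/cvg_pinftyP => u uoo.
have [] := @dominated_convergence _ _ _ m D mD
  (fun n t => (tail_weight l (u n) t)%:E) (cst 0%E) (fun t => `|t ^+ l|%:E).
- by move=> n; apply/measurable_EFinP; exact: measurable_tail_weight.
- exact: measurable_cst.
- apply: aeW => t _; apply: cvg_EFin; first exact: nearW.
  exact: (cvg_comp _ _ uoo (tail_weight_cvg0 l t)).
- exact: (integrable_norm il).
- apply: aeW => t n _.
  by rewrite /= lee_fin ger0_norm ?tail_weight_ge0// tail_weight_le.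
move=> _ _; rewrite integral_cst// mul0e => h.
exact: (fine_cvg h).
Qed.

End tail.

Section remainder_bound.
Context {R : realType} {q : nat} {Omega : set R}.
Hypothesis mOmega : measurable (Omega : set (measurableTypeR R)).
Variable sigma : nnherm_measure q Omega.
Variables (s : nat -> 'M[R[i]]_q) (l : nat).
Hypothesis hs : has_moments sigma s l.+1.

Let mom_int k :
  (diag_measure sigma k).-integrable Omega (EFin \o (fun t => t ^+ l)).
Proof. by have [] := mx_integrable_diag mOmega k (hs (ltnSn l)).1. Qed.

Definition remainder_bound (c r : R) : R :=
  (16 * q)%:R * (c^-1 * \sum_k Rintegral (diag_measure sigma k) Omega (tail_weight l r)).

(** The bound depends on z only through its distances to the real line, which
    makes it uniform over a sector. *)
Lemma frobenius_remainder_le z c r : 0 < c -> 0 < r -> Im z != 0 ->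
  (forall t, c * `|t| <= normc (t%:C - z)) ->
  (forall t, c * r <= normc (t%:C - z)) ->
  frobenius (stieltjes_remainder (stieltjes sigma z) s z l.+1) <=
  remainder_bound c r.
Proof.
move=> c0 r0 z0 h1 h2.
have [_ ->] := remainder_integral mOmega z0 hs.
have tw_int k : (diag_measure sigma k).-integrable Omega
    (EFin \o tail_weight l r).
  apply: (le_integrable mOmega _ _ (mom_int k)).
    by apply/measurable_EFinP; exact: measurable_tail_weight.
  by move=> t _ /=; rewrite lee_fin ger0_norm ?tail_weight_ge0// tail_weight_le.
rewrite /remainder_bound mulr_sumr.
rewrite (eq_bigr (fun k => Rintegral (diag_measure sigma k) Omega
    (fun t => c^-1 * tail_weight l r t))); last first.
  by move=> k _; rewrite RintegralZl//; exact: tw_int.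
have mX n : measurable_fun (Omega : set (measurableTypeR R)) (fun t : R => t ^+ n).
  by apply: measurable_funX.
apply: frobenius_mx_integral_le => //.
- rewrite (_ : _ \o _ = fun t => t ^+ l.+1 * Re (t%:C - z)^-1); last first.
    by apply/funext => t /=; rewrite ReZ.
  by apply: measurable_funM => //; exact: measurable_cauchy_Re.
- rewrite (_ : _ \o _ = fun t => t ^+ l.+1 * Im (t%:C - z)^-1); last first.
    by apply/funext => t /=; rewrite ImZ.
  by apply: measurable_funM => //; exact: measurable_cauchy_Im.
- move=> t _; rewrite ComplexField.Normc.normcM normc_real ComplexField.Normc.normcV.
  have cr0 : 0 < c * r by rewrite mulr_gt0.
  have N0 : 0 < normc (t%:C - z) := lt_le_trans cr0 (h2 t).
  rewrite /tail_weight normrX exprSr mulrCA -mulrA ler_wpM2l ?exprn_ge0//.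
  rewrite minr_pMr; last by rewrite invr_ge0 ltW.
  rewrite le_min mulr1 normrM normfV (gtr0_norm r0).
  apply/andP; split; first by rewrite ler_pdivrMr// ler_pdivlMl.
  by rewrite mulrCA ler_wpM2l// -invfM lef_pV2 ?posrE.
- move=> k; apply: (integrableZl mOmega c^-1 (tw_int k)).
Qed.

Lemma remainder_bound_cvg0 c : remainder_bound c r @[r --> +oo] --> (0 : R).
Proof.
have h : remainder_bound c r @[r --> +oo] -->
    (16 * q)%:R * (c^-1 * \sum_(k < q) (0 : R)).
  apply: cvgM; first exact: cvg_cst.
  apply: cvgM; first exact: cvg_cst.
  apply: cvg_big => [|k _]; first exact: add_continuous.
  by apply: tail_integral_cvg0; [exact: mOmega|exact: mom_int].
by rewrite big1// !mulr0 in h.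
Qed.

End remainder_bound.

(** * Distance from a sector to the real line *)

Section sector_geometry.
Context {R : realType}.

(** The value 0 is also the default of the choice operator in [carg], so only a
    nonzero value is certain to be an argument. *)
Lemma cargP (z : R[i]) : carg z != 0 ->
  z = (normc z)%:C * (cos (carg z) +i* sin (carg z)).
Proof.
rewrite /carg; case: xgetP => [phi _ [_ zE] _|]; first exact: zE.
by rewrite eqxx.
Qed.

(** The cosine vanishes and the sine is positive, which selects pi/2 among the
    angles in ]-pi, pi]. *)
Lemma carg_imaginary (y : R) : 0 < y -> carg (y *i) = pi / 2.
Proof.
move=> y0; have yn : normc (y *i) = y by rewrite /= expr0n add0r sqrtr_sqr gtr0_norm.
have pi0 : (0 : R) < pi := pi_gt0 R.
rewrite /carg yn; case: xgetP => [phi _ [/andP[p1 p2]]|/(_ (pi / 2))]; last first.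
  case; split; first by apply/andP; split; lra.
  rewrite cos_pihalf sin_pihalf /=; apply/eqP; rewrite eq_complex /=.
  by apply/andP; split; apply/eqP; ring.
move=> /eqP; rewrite eq_complex /= !mul0r subr0 addr0 => /andP[].
rewrite eq_sym mulf_eq0 (gt_eqF y0)/= => /eqP c0 /eqP.
rewrite -[LHS]mulr1 => /(mulfI (lt0r_neq0 y0)) s1.
have phi_gt0 : 0 < phi.
  rewrite ltNge; apply/negP => phi0.
  have : 0 <= sin (- phi) by apply: sin_ge0_pi; apply/andP; split; lra.
  by rewrite sinN -s1; lra.
apply: (@cos_inj R); rewrite ?in_itv/= ?cos_pihalf//; apply/andP; split; lra.
Qed.

(** For z = rho (cos phi + i sin phi), the number |t - z|^2 equals both
    (t - rho cos phi)^2 + (rho sin phi)^2 and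
    (rho - t cos phi)^2 + (t sin phi)^2, hence is at least (sin phi)^2 times
    either of rho^2 and t^2. In the sector |cos phi| <= cos delta, so
    sin phi >= sin delta. *)
Lemma sector_bounds (r delta : R) (z : R[i]) : 0 < r -> 0 < delta <= pi / 2 ->
  sector r delta z ->
  [/\ 0 < sin delta, Im z != 0,
   forall t, sin delta * `|t| <= normc (t%:C - z) &
   forall t, sin delta * r <= normc (t%:C - z)].
Proof.
move=> r0 /andP[d0 d2] [rz /andP[dp pd]].
have pi0 : (0 : R) < pi := pi_gt0 R.
have p0 : carg z != 0 by rewrite gt_eqF// (lt_le_trans d0).
have := cargP p0; set phi := carg z in dp pd *; move: rz; set rho := normc z => rz zE.
have sd0 : 0 < sin delta by apply: sin_gt0_pi; apply/andP; split; lra.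
have sp0 : 0 < sin phi by apply: sin_gt0_pi; apply/andP; split; lra.
have rho0 : 0 < rho := lt_le_trans r0 rz.
have normc_ge (x t : R) : 0 <= x ->
    x ^+ 2 <= (t - rho * cos phi) ^+ 2 + (rho * sin phi) ^+ 2 ->
    x <= normc (t%:C - z).
  move=> x0 h; rewrite zE /= -[x]ger0_norm// -sqrtr_sqr ler_wsqrtr//.
  apply: le_trans h _; rewrite le_eqVlt; apply/orP; left; apply/eqP; ring.
have c1 : cos phi <= cos delta.
  by rewrite leNgt ltr_cos ?in_itv/= -?leNgt//; apply/andP; split; lra.
have c2 : - cos delta <= cos phi.
  rewrite -cosN -cosDpi leNgt ltr_cos ?in_itv/= -?leNgt;
    by [lra|apply/andP; split; lra].
have cs := cos2Dsin2 phi; have csd := cos2Dsin2 delta.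
have cc : cos phi ^+ 2 <= cos delta ^+ 2.
  rewrite -subr_ge0 subr_sqr mulr_ge0//; lra.
have ss : sin delta ^+ 2 <= sin phi ^+ 2 by lra.
split => //.
- by rewrite zE ImZ mulf_neq0// lt0r_neq0.
- move=> t; apply: normc_ge; first by rewrite mulr_ge0// ltW.
  rewrite exprMn real_normK ?num_real//.
  apply: (@le_trans _ _ (sin phi ^+ 2 * t ^+ 2)); first by rewrite ler_wpM2r ?sqr_ge0.
  rewrite -subr_ge0 [leRHS](_ : _ = (t * cos phi - rho) ^+ 2) ?sqr_ge0//.
  rewrite [(rho * sin phi) ^+ 2]exprMn.
  have -> : sin phi ^+ 2 = 1 - cos phi ^+ 2 by lra.
  by ring.
- move=> t; apply: normc_ge; first by rewrite mulr_ge0// ltW.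
  apply: (@le_trans _ _ ((rho * sin phi) ^+ 2)); last by rewrite lerDr sqr_ge0.
  have sdp : sin delta <= sin phi by move: ss; rewrite ler_sqr// nnegrE ltW.
  have rs : sin delta * r <= rho * sin phi.
    by rewrite mulrC; apply: ler_pM => //; exact: ltW.
  by rewrite ler_sqr// nnegrE ltW// mulr_gt0.
Qed.

Lemma imaginary_bounds (y t : R) : 0 < y ->
  1 * `|t| <= normc (t%:C - y *i) /\ 1 * y <= normc (t%:C - y *i).
Proof.
move=> y0; rewrite !mul1r; split.
  by apply: le_trans (Re_le_normc _); rewrite /= subr0.
by apply: le_trans (Im_le_normc _); rewrite /= sub0r normrN ler_norm.
Qed.

End sector_geometry.

(** * The expansion from the moments *)

Section part_a.
Context {R : realType} {q : nat} {Omega : set R}.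
Hypothesis mOmega : measurable (Omega : set (measurableTypeR R)).
Variable sigma : nnherm_measure q Omega.

(** The supremum is squeezed between 0 and [remainder_bound]. The lower bound
    is not automatic, since the supremum of an empty set is -oo: the point r i
    of the imaginary axis shows that the sector is inhabited. *)
Lemma sector_remainder_cvg0 s l (delta : R) : has_moments sigma s l.+1 ->
  0 < delta <= pi / 2 ->
  ereal_sup [set (frobenius
    (stieltjes_remainder (stieltjes sigma z) s z l.+1))%:E
  | z in sector r delta] @[r --> +oo] --> 0%E.
Proof.
move=> hs d12; have pi0 : (0 : R) < pi := pi_gt0 R.
have h : (remainder_bound sigma l (sin delta) r)%:E @[r --> +oo] --> (0 : R)%:E.
  by apply: cvg_EFin; [exact: nearW|exact: (remainder_bound_cvg0 mOmega hs)].
apply: squeeze_cvge h; last exact: (@cvg_cst _ (0%E : \bar R)).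
near=> r; have r0 : 0 < r by near: r; exact: nbhs_pinfty_gt.
apply/andP; split.
  apply: le_ereal_sup_tmp; exists (frobenius
    (stieltjes_remainder (stieltjes sigma (r *i)) s (r *i) l.+1))%:E.
    exists (r *i) => //; split.
      by rewrite /= expr0n add0r sqrtr_sqr gtr0_norm.
    by rewrite carg_imaginary//; move/andP: d12 => [d1 d2]; apply/andP; split; lra.
  by rewrite lee_fin frobenius_ge0.
apply: ge_ereal_sup => _ [z zs <-].
have [sd0 z0 h1 h2] := sector_bounds r0 d12 zs.
by rewrite lee_fin; apply: frobenius_remainder_le.
Unshelve. all: by end_near. Qed.

Lemma imaginary_remainder_cvg0 s l : has_moments sigma s l.+1 ->
  frobenius (stieltjes_remainder (stieltjes sigma (y *i)) s (y *i) l.+1)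
    @[y --> +oo] --> (0 : R).
Proof.
move=> hs; apply: squeeze_cvgr (remainder_bound_cvg0 mOmega hs 1);
  last exact: (@cvg_cst _ (0 : R)).
near=> y; have y0 : 0 < y by near: y; exact: nbhs_pinfty_gt.
rewrite frobenius_ge0 frobenius_remainder_le//=; first by rewrite gt_eqF.
  by move=> t; have [] := imaginary_bounds t y0.
by move=> t; have [] := imaginary_bounds t y0.
Unshelve. all: by end_near. Qed.

End part_a.

(** * Integrability of a power from its damped integrals *)

Section damped_moments.
Context {R : realType}.

Lemma limn_einf_le (u : (\bar R)^nat) (M : \bar R) :
  (forall n, (u n <= M)%E) -> (limn_einf u <= M)%E.
Proof.
move=> uM; rewrite limn_einf_lim; apply: lime_le; first exact: is_cvg_einfs.
apply: nearW => n; apply: le_trans (uM n).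
by apply: ereal_inf_lbound; exists n => /=.
Qed.

(** This is y^2/(t^2 + y^2), the function y Im (1/(t - iy)). *)
Definition damping (y t : R) : R := (1 + (t / y) ^+ 2)^-1.

Lemma damping_gt0 y t : 0 < damping y t.
Proof. by rewrite invr_gt0 ltr_wpDr ?sqr_ge0. Qed.

Lemma damping_le1 y t : damping y t <= 1.
Proof. by rewrite invf_le1 ?lerDl ?sqr_ge0// ltr_wpDr ?sqr_ge0. Qed.

Lemma damping_cvg1 t : damping y t @[y --> +oo] --> (1 : R).
Proof.
have c0 : t / y @[y --> +oo] --> t * 0.
  apply: cvgM; first exact: cvg_cst.
  by apply/gtr0_cvgV0; [exact: nbhs_pinfty_gt|exact: cvg_id].
rewrite mulr0 in c0.
have c1 : 1 + (t / y) ^+ 2 @[y --> +oo] --> 1 + (0 : R) * 0.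
  by apply: cvgD; [exact: cvg_cst|exact: cvgM].
rewrite mulr0 addr0 in c1.
by rewrite -[X in _ --> X]invr1; apply: cvgV.
Qed.

Lemma Im_cauchy_imaginary y t : 0 < y ->
  y * Im ((t%:C - y *i)^-1) = damping y t.
Proof.
move=> y0; rewrite /damping /= subr0 sub0r sqrrN mulNr opprK.
field.
by rewrite !gt_eqF// ltr_pwDl ?sqr_ge0 ?exprn_gt0.
Qed.

Lemma measurable_damping (D : set (measurableTypeR R)) y :
  measurable_fun D (damping y).
Proof.
apply: measurable_funTS; apply: continuous_measurable_fun => t.
have c1 : (fun u : R => u / y) @ t --> t / y by apply: cvgM; [|exact: cvg_cst].
apply: cvgV; first by rewrite gt_eqF// ltr_wpDr ?sqr_ge0.
by apply: cvgD; [exact: cvg_cst|exact: cvgM].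
Qed.

Variables (m : {finite_measure set (measurableTypeR R) -> \bar R}).
Variables (D : set (measurableTypeR R)) (mD : measurable D).
Variables (k : nat) (e c L : R).
Hypothesis c0 : 0 <= c.
Hypothesis one_sided : forall t, D t -> `|t| ^+ k <= e * t ^+ k + c.
Hypothesis damped_int : forall y, 0 < y ->
  m.-integrable D (EFin \o (fun t => t ^+ k * damping y t)).
Hypothesis damped_cvg :
  Rintegral m D (fun t => t ^+ k * damping y t) @[y --> +oo] --> L.

Let pw y t := t ^+ k * damping y t.
Let g y t := e * pw y t + c.
Let f y t := `|t| ^+ k * damping y t.

Let fg y t : D t -> f y t <= g y t.
Proof.
move=> Dt; apply: (@le_trans _ _ ((e * t ^+ k + c) * damping y t)).
  by rewrite ler_wpM2r ?one_sided// ltW// damping_gt0.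
by rewrite mulrDl -mulrA lerD2l ler_piMr// damping_le1.
Qed.

Let mf y : measurable_fun D (f y).
Proof.
apply: measurable_funM; last exact: measurable_damping.
by apply: measurable_funX; exact: normr_measurable.
Qed.

Let f_ge0 y t : 0 <= f y t.
Proof. by rewrite mulr_ge0 ?exprn_ge0// ltW// damping_gt0. Qed.

Let int_c : m.-integrable D (EFin \o cst c).
Proof. exact: finite_measure_integrable_cst. Qed.

Let int_f y : 0 < y ->
  (\int[m]_(t in D) (f y t)%:E <=
   (e * Rintegral m D (pw y) + Rintegral m D (cst c))%:E)%E.
Proof.
move=> y0; have ip := damped_int y0.
have iep : m.-integrable D (EFin \o (fun t => e * pw y t)).
  exact: (integrableZl mD e ip).
have ig : m.-integrable D (EFin \o g y) := integrableD mD iep int_c.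
have if_ : m.-integrable D (EFin \o f y).
  apply: le_integrable ig => //; first exact/measurable_EFinP.
  by move=> t Dt; rewrite /= lee_fin ger0_norm// (le_trans (fg y Dt))// ler_norm.
rewrite -RintegralZl// -RintegralD//.
rewrite -[leLHS]fineK; last exact: integrable_fin_num.
by rewrite lee_fin; apply: le_Rintegral => // t Dt; exact: fg.
Qed.

(** On D the function |t|^k is, up to the constant c, at most e t^k. The damped
    integrals of t^k converge, hence those of |t|^k stay bounded; as the
    damping factor tends to 1, the integral of |t|^k is finite by Fatou's
    lemma. *)
Lemma damped_moment_integrable : m.-integrable D (EFin \o (fun t => t ^+ k)).
Proof.
have /cvgr_dist_le /(_ _ ltr01) [A [_ hA]] := damped_cvg.
(* A sequence that tends to infinity inside the range where the damped integral
   is within 1 of its limit L. *)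
pose y n := Num.max A 0 + 1 + n%:R.
have yA n : A < y n.
  by rewrite /y -addrA (@le_lt_trans _ _ (Num.max A 0)) ?le_max ?lexx// ltrDl ltr_pwDl.
have y0 n : 0 < y n.
  rewrite /y -addrA (@le_lt_trans _ _ (Num.max A 0)) ?le_max ?lexx ?orbT//.
  by rewrite ltrDl ltr_pwDl.
pose M := `|e| * (`|L| + 1) + Rintegral m D (cst c).
have fM n : (\int[m]_(t in D) (f (y n) t)%:E <= M%:E)%E.
  apply: (le_trans (int_f (y0 n))); rewrite lee_fin lerD2r.
  apply: (le_trans (ler_norm _)); rewrite normrM ler_wpM2l//.
  have := hA _ (yA n) => /=; rewrite -/(pw (y n)) => h.
  by rewrite -[X in `|X|](subKr L) (le_trans (ler_normB _ _))// lerD2l.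
have yoo : y n @[n --> \oo] --> +oo.
  apply: (ger_cvgy _ cvgr_idn).
  by apply: nearW => n; rewrite lerDr addr_ge0// le_max lexx orbT.
have fcvg t : (f (y n) t)%:E @[n --> \oo] --> (`|t| ^+ k)%:E.
  apply: cvg_EFin; first exact: nearW.
  rewrite -[X in _ --> X]mulr1; apply: cvgM; first exact: cvg_cst.
  exact: (cvg_comp _ _ yoo (damping_cvg1 t)).
apply/integrableP; split; first by apply/measurable_EFinP; exact: measurable_funX.
apply: (@le_lt_trans _ _ M%:E); last exact: ltry.
rewrite (eq_integral (fun t : measurableTypeR R =>
  limn_einf (fun n => (f (y n) t)%:E))); last first.
  by move=> t _; rewrite (cvg_limn_einf_sup (fcvg t)).1 /= normrX.
apply: le_trans (limn_einf_le fM); apply: fatou => // n.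
  exact/measurable_EFinP.
by move=> t _; rewrite lee_fin.
Qed.

End damped_moments.

(** * Powers on semibounded sets *)

Section one_sided_sets.
Context {R : realType}.

(** For t < 0 one has |t| <= |a|, so t^k >= - |a|^k and |t|^k <= |a|^k; the
    factor 2 absorbs both. *)
Lemma lower_bound_one_sided (a t : R) k : a <= t ->
  `|t| ^+ k <= t ^+ k + `|a| ^+ k *+ 2.
Proof.
move=> at_; have [t0|t0] := leP 0 t.
  by rewrite ger0_norm// lerDl mulrn_wge0// exprn_ge0.
have ta : `|t| ^+ k <= `|a| ^+ k.
  apply: lerXn2r; rewrite ?nnegrE//.
  by rewrite !ltr0_norm ?lerN2// (le_lt_trans at_).
rewrite mulr2n addrCA (le_trans ta)// lerDl.
by rewrite addrC -lerBlDr sub0r (le_trans _ ta)// -normrX lerNl; apply: lerNnormlW.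
Qed.

(** The sign e is 1 when Omega is bounded below, and (-1)^k, by the reflection
    t |-> - t, when Omega is bounded above. *)
Lemma semibounded_one_sided (Omega : set R) (k : nat) :
  (Order.min `|ereal_inf (EFin @` Omega)| `|ereal_sup (EFin @` Omega)|
     < +oo)%E ->
  exists e c : R, 0 <= c /\ forall t, Omega t -> `|t| ^+ k <= e * t ^+ k + c.
Proof.
rewrite gt_min => /orP[].
  case E : (ereal_inf _) => [a| |]// _.
  exists 1, (`|a| ^+ k *+ 2); split; first by rewrite mulrn_wge0// exprn_ge0.
  move=> t Ot; rewrite mul1r; apply: lower_bound_one_sided.
  by rewrite -lee_fin -E; apply: ereal_inf_lbound; exists t.
case E : (ereal_sup _) => [b| |]// _.
exists ((-1) ^+ k), (`|b| ^+ k *+ 2); split; first by rewrite mulrn_wge0// exprn_ge0.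
move=> t Ot; rewrite -exprNn -normrN -(normrN b); apply: lower_bound_one_sided.
by rewrite lerN2 -lee_fin -E; apply: ereal_sup_ubound; exists t.
Qed.

End one_sided_sets.

(** * The moments from the expansion *)

Section induction_step.
Context {R : realType} {q : nat} {Omega : set R}.
Hypothesis mOmega : measurable (Omega : set (measurableTypeR R)).
Variable sigma : nnherm_measure q Omega.
Variable s : nat -> 'M[R[i]]_q.

Local Notation rem_cvg0 s l := (frobenius
  (stieltjes_remainder (stieltjes sigma (y *i)) s (y *i) l) @[y --> +oo] --> (0 : R)).

(** The recursion for the remainder, solved for its previous value, divides by
    z = iy what stays bounded. *)
Lemma remainder_cvg0_pred l : rem_cvg0 s l.+1 -> rem_cvg0 s l.
Proof.
move=> h.
have h1 : (q * q)%:R * (y^-1 * (frobenius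
    (stieltjes_remainder (stieltjes sigma (y *i)) s (y *i) l.+1) + frobenius (s l)))
    @[y --> +oo] --> (q * q)%:R * (0 * (0 + frobenius (s l))).
  apply: cvgM; first exact: cvg_cst.
  apply: cvgM; last by apply: cvgD => //; exact: cvg_cst.
  by apply/gtr0_cvgV0; [exact: nbhs_pinfty_gt|exact: cvg_id].
rewrite mul0r mulr0 in h1.
apply: squeeze_cvgr h1; last exact: (@cvg_cst _ (0 : R)).
near=> y; have y0 : 0 < y by near: y; exact: nbhs_pinfty_gt.
rewrite frobenius_ge0/=.
have z0 : y *i != 0 by apply: Im_neq0_neq0; rewrite /= gt_eqF.
set A := stieltjes_remainder _ _ _ l.+1.
apply: (le_trans (frobenius_le_sum _)).
rewrite mulr_natl mulrnA -[X in _ *+ X *+ _]card_ord -sumr_const.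
rewrite -[X in _ *+ X]card_ord -sumr_const.
apply: ler_sum => i _; apply: ler_sum => j _.
have := stieltjes_remainderS (stieltjes sigma (y *i)) s l z0.
move=> /(congr1 (fun A => (y *i)^-1 *: (A - s l)))/=.
rewrite addrK scalerA mulVf// scale1r -/A => <-.
rewrite mxE ComplexField.Normc.normcM ComplexField.Normc.normcV.
rewrite (_ : normc (y *i) = y); last by rewrite /= expr0n add0r sqrtr_sqr gtr0_norm.
rewrite ler_wpM2l ?invr_ge0 ?(ltW y0)// [(A - s l) i j]mxE [(- s l) i j]mxE.
apply: (le_trans (le_normcD _ _)); rewrite normcN.
apply: lerD; exact: normc_le_frobenius.
Unshelve. all: by end_near. Qed.

Lemma remainder_cvg0_le l n : (l <= n)%N -> rem_cvg0 s n -> rem_cvg0 s l.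
Proof.
move=> /subnK <-; elim: (n - l)%N => [h|d ih]; first exact: h.
by rewrite addSn => /remainder_cvg0_pred.
Qed.

(** Since the remainder at [k.+1] is z times the integral of t^k/(t-z), plus
    [s k], taking the real part of a diagonal entry at z = iy shows that the
    damped integral of t^k differs from Re (s k i i) by a quantity that tends
    to 0. *)
Lemma damped_moment_cvg k i : has_moments sigma s k -> rem_cvg0 s k.+1 ->
  (forall y, 0 < y -> (diag_measure sigma i).-integrable Omega
    (EFin \o (fun t => t ^+ k * damping y t))) /\
  Rintegral (diag_measure sigma i) Omega (fun t => t ^+ k * damping y t)
    @[y --> +oo] --> Re (s k i i).
Proof.
move=> hs hr.
have key (y : R) : 0 < y ->
    (diag_measure sigma i).-integrable Omega
      (EFin \o (fun t => t ^+ k * damping y t)) /\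
    Rintegral (diag_measure sigma i) Omega (fun t => t ^+ k * damping y t) =
    Re (s k i i) -
    Re (stieltjes_remainder (stieltjes sigma (y *i)) s (y *i) k.+1 i i).
  move=> y0; have z0 : Im (y *i) != 0 by rewrite /= gt_eqF.
  have [fi fe] := remainder_integral mOmega z0 hs.
  have [_ iIm] := mx_integrable_diag mOmega i fi.
  have E : (fun t : R => t ^+ k * damping y t) =
      (fun t => y * (@Im R \o (fun t => (t ^+ k)%:C * (t%:C - y *i)^-1)) t).
    by apply/funext => t; rewrite [in RHS]/comp ImZ mulrCA Im_cauchy_imaginary.
  split; first by rewrite E; exact: (integrableZl mOmega y iIm).
  rewrite E RintegralZl// -mx_integral_diag// -fe.
  rewrite stieltjes_remainderS ?Im_neq0_neq0//.
  move: (stieltjes_remainder _ _ _ k) => A; rewrite !mxE.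
  by case: (A i i) (s k i i) => [a b] [c d] /=; ring.
split; first by move=> y /key[].
have h : Re (s k i i) -
    Re (stieltjes_remainder (stieltjes sigma (y *i)) s (y *i) k.+1 i i)
    @[y --> +oo] --> Re (s k i i) - 0.
  apply: cvgB; first exact: cvg_cst.
  apply/norm_cvg0P; apply: squeeze_cvgr hr; last exact: (@cvg_cst _ (0 : R)).
  by apply: nearW => y; rewrite normr_ge0 Re_le_frobenius.
rewrite subr0 in h; apply: cvg_trans h.
apply: near_eq_cvg; near=> y.
by apply/esym/(key y _).2; near: y; exact: nbhs_pinfty_gt.
Unshelve. all: by end_near. Qed.

Lemma diag_integrable_moment k :
  (forall i, (diag_measure sigma i).-integrable Omega
    (EFin \o (fun t => t ^+ k))) -> mx_integrable sigma (fun t => (t ^+ k)%:C).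
Proof.
move=> hi; apply: (@mx_integrable_dominated _ _ _ mOmega _ _
  (fun t => `|t ^+ k|)) => //.
- by apply: measurable_funX.
- exact: (@measurable_cst _ _ _ _ _ (0 : R)).
- by move=> t _; rewrite normc_real.
- by move=> i; exact: (integrable_norm (hi i)).
Qed.

(** The actual k-th moment I satisfies the expansion too, by
    [imaginary_remainder_cvg0]. The two remainders at [k.+1] differ by the
    constant I - [s k], which therefore vanishes. *)
Lemma has_momentsS k : has_moments sigma s k -> rem_cvg0 s k.+1 ->
  mx_integrable sigma (fun t => (t ^+ k)%:C) -> has_moments sigma s k.+1.
Proof.
move=> hs hr ik; pose I := mx_integral sigma (fun t => (t ^+ k)%:C).
pose s' j := if j == k then I else s j.
have hs' : has_moments sigma s' k.+1.
  move=> j; rewrite ltnS leq_eqVlt /s' => /orP[/eqP ->|jk]; first by rewrite eqxx.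
  by rewrite (ltn_eqF jk); exact: hs.
have hr' := imaginary_remainder_cvg0 mOmega hs'.
suff Isk : I = s k.
  by move=> j; rewrite ltnS leq_eqVlt => /orP[/eqP ->|/hs].
have hk : has_moments sigma s' k by move=> j jk; apply: hs'; exact: ltnW.
apply/eqP; rewrite -subr_eq0; apply/eqP/matrixP => i j; rewrite [RHS]mxE.
have h : normc ((I - s k) i j) <= 0.
  have h0 : frobenius (stieltjes_remainder (stieltjes sigma (y *i)) s' (y *i) k.+1) +
      frobenius (stieltjes_remainder (stieltjes sigma (y *i)) s (y *i) k.+1)
      @[y --> +oo] --> (0 + 0 : R).
    by apply: cvgD; [exact: hr'|exact: hr].
  rewrite addr0 in h0.
  rewrite -(cvg_lim _ h0)//; apply: limr_ge; first by apply/cvg_ex; exists 0.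
  near=> y; have y0 : 0 < y by near: y; exact: nbhs_pinfty_gt.
  have z0 : Im (y *i) != 0 by rewrite /= gt_eqF.
  have -> : I - s k = stieltjes_remainder (stieltjes sigma (y *i)) s' (y *i) k.+1 -
      stieltjes_remainder (stieltjes sigma (y *i)) s (y *i) k.+1.
    rewrite !stieltjes_remainderS ?Im_neq0_neq0// {2}/s' eqxx.
    rewrite (remainder_integral mOmega z0 hs).2 (remainder_integral mOmega z0 hk).2.
    by rewrite opprD addrACA subrr add0r.
  rewrite [X in normc X]mxE [X in normc (_ + X)]mxE.
  by apply: (le_trans (le_normcD _ _)); rewrite normcN;
    apply: lerD; exact: normc_le_frobenius.
by apply: ComplexField.Normc.eq0_normc; apply/eqP; rewrite eq_le h normc_ge0.
Unshelve. all: by end_near. Qed.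

(** By induction on the number k of moments already identified; nothing has to
    be shown for k = 0. For each diagonal measure, [damped_moment_cvg] and
    [damped_moment_integrable] give the integrability of t^k, which
    domination extends to all entries, and [has_momentsS] identifies the
    moment. *)
Lemma has_moments_of_asymptotics n :
  (Order.min `|ereal_inf (EFin @` Omega)| `|ereal_sup (EFin @` Omega)|
     < +oo)%E ->
  rem_cvg0 s n -> has_moments sigma s n.
Proof.
move=> semib hn.
suff : forall k, (k <= n)%N -> has_moments sigma s k by exact.
elim=> [//|k ih kn]; have hk := ih (ltnW kn).
have hr := remainder_cvg0_le kn hn.
apply: has_momentsS => //; apply: diag_integrable_moment => i.
have [e [c [c0 ec]]] := semibounded_one_sided k semib.
have [hi hl] := damped_moment_cvg i hk hr.
exact: (damped_moment_integrable mOmega c0 ec hi hl).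
Qed.

End induction_step.

Theorem theorem6p1 (R : realType) (q : nat) (hq : (0 < q)%N)
    (Omega : set R) (hne : Omega !=set0) (hcl : closed Omega)
    (m : nat) (s : 'I_m.+1 -> 'M[R[i]]_q) :
  (forall sigma : nnherm_measure q Omega, moment_class Omega s sigma ->
    forall (l : 'I_m.+1) (delta : R), 0 < delta <= pi / 2 ->
    ereal_sup [set (frobenius (z ^+ l.+1 *:
        (stieltjes sigma z + \sum_(j < m.+1 | (j <= l)%N) z ^- j.+1 *: s j)))%:E
      | z in sector r delta] @[r --> +oo] --> 0%E)
  /\
  ((Order.min `|ereal_inf (EFin @` Omega)| `|ereal_sup (EFin @` Omega)|
     < +oo)%E ->
   (forall j : 'I_m.+1, s j \is hermsymmx) ->
   forall sigma : nnherm_measure q Omega,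
    frobenius ((y *i) ^+ m.+1 *:
        (stieltjes sigma (y *i) + \sum_(j < m.+1) (y *i) ^- j.+1 *: s j))
      @[y --> +oo] --> (0 : R) ->
    moment_class Omega s sigma).
Proof.
have mOmega : measurable (Omega : set (measurableTypeR R)).
  exact: closed_measurable.
pose s' (j : nat) := s (inord j).
have sE (j : 'I_m.+1) : s j = s' j by rewrite /s' inord_val.
split=> [sigma hs l delta hd|semib _ sigma hs].
  have hl : has_moments sigma s' l.+1.
    move=> j jl; have jm : (j < m.+1)%N := leq_trans jl (ltn_ord l).
    by have := hs (Ordinal jm); rewrite sE.
  rewrite (_ : (fun r => _) = (fun r => ereal_sup [set (frobenius
      (stieltjes_remainder (stieltjes sigma z) s' z l.+1))%:E
      | z in sector r delta])); first exact: sector_remainder_cvg0.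
  apply/funext => r; apply: (congr1 (@ereal_sup R)); apply: eq_imagel => z _.
  congr (frobenius (_ *: (_ + _)))%:E.
  rewrite [RHS](big_ord_widen m.+1 (fun j => z ^- j.+1 *: s' j) (ltn_ord l)).
  by apply: eq_bigr => j _; rewrite sE.
have hs' : has_moments sigma s' m.+1.
  apply: (has_moments_of_asymptotics mOmega semib).
  rewrite (_ : (fun y => _) = (fun y => frobenius ((y *i) ^+ m.+1 *:
    (stieltjes sigma (y *i) + \sum_(j < m.+1) (y *i) ^- j.+1 *: s j)))).
    exact: hs.
  apply/funext => y; congr (frobenius (_ *: (_ + _))).
  by apply: eq_bigr => j _; rewrite sE.
move=> j; rewrite sE; exact: hs'.
Qed.
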